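(* (a) There is an absolute constant $c_0>0$ such that for every odd prime $q$, the number of block-columns in the parity-check matrix of a shortened proper array code (PAC) with modulus $q$, column weight $r\ge 3$ and girth eight is at most $c_0\,q/\log\log q$. (b) For every odd prime $q$, the number of block-columns in the parity-check matrix of a shortened array code with modulus $q$, column weight $r\ge 2$ and girth ten is at most $\sqrt{q-3/4}+1/2$.
   Context: For integers $a\le b$, $[a,b]=\{x\in\mathbb{Z}: a\le x\le b\}$. Let $q$ be an odd prime, $I$ the $q\times q$ identity matrix and $P\ne I$ a $q\times q$ circulant permutation matrix. Given $r\in[1,q]$ and distinct integers $a_0,\dots,a_{r-1}\in[0,q-1]$ (block-row labels), the array code with modulus $q$ has parity-check matrix $H$ formed by an $r\times q$ array of $q\times q$ blocks, the block in block-row $i\in[0,r-1]$ and block-column $j\in[0,q-1]$ being $P^{a_i\cdot j}$; its column weight is $r$. It is a proper array code (PAC) if $a_0,\dots,a_{r-1}$ is an arithmetic progression with nonzero common difference, and an array code in general (any distinct labels). A shortened array code is the code whose parity-check matrix is obtained from $H$ by deleting a set of block-columns. The girth of a code is the length of a shortest cycle in its Tanner graph (the bipartite graph with a vertex for each column and each row of the parity-check matrix, column and row vertices adjacent iff the corresponding entry is $1$). $\log$ is the natural logarithm. *)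

(* Defs.v *)
From HB Require Import structures.
From mathcomp Require Import all_boot all_order all_algebra.
From mathcomp Require Import reals exp.

Set Implicit Arguments.
Unset Strict Implicit.
Unset Printing Implicit Defensive.

Import Order.TTheory GRing.Theory Num.Theory.
Local Open Scope ring_scope.

(* The entry at (i, j) depends only on j - i modulo n. *)
Definition circulant (n : nat) (A : 'M['F_2]_n) : Prop :=
  forall i j i' j' : 'I_n,
    (j + i' = j' + i %[mod n])%N -> A i j = A i' j'.

Definition nontrivial_circulant_perm (n : nat) (P : 'M['F_2]_n) : Prop :=
  [/\ circulant P, is_perm_mx P & P != 1%:M].

Definition array_pcm (q r : nat) (P : 'M['F_2]_q) (a : 'I_r -> 'I_q) :
    'M['F_2]_(\sum_(i < r) q, \sum_(j < q) q) :=
  \mxblock_(i < r, j < q) (P ^+ (a i * j)).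

(* D is the set of deleted block-columns; #|~: D| block-columns remain. *)
Definition delete_block_cols (m k q : nat) (D : {set 'I_k})
    (H : 'M['F_2]_(m, \sum_(j < k) q)) :
    'M['F_2]_(m, \sum_(j < #|~: D|) q) :=
  \mxrow_(j < #|~: D|) submxrow H (enum_val j).

(* The progression is taken in the integers, not modulo q. *)
Definition arithmetic_progression (q r : nat) (a : 'I_r -> 'I_q) : Prop :=
  exists b d : int, d != 0 /\ forall i : 'I_r, (a i)%:Z = b + d *+ i.

Definition tanner (m n : nat) (H : 'M['F_2]_(m, n)) : rel ('I_n + 'I_m) :=
  fun u v => match u, v with
  | inl c, inr s => H s c == 1
  | inr s, inl c => H s c == 1
  | _, _ => false
  end.

(* [ucycle] also accepts the empty sequence, and [:: x; y] when x and y are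
   adjacent: the bound on the size excludes them. *)
Definition simple_cycle (T : finType) (e : rel T) (c : seq T) : Prop :=
  ucycle e c /\ (2 < size c)%N.

(* An acyclic graph has no finite girth. *)
Definition has_girth (T : finType) (e : rel T) (g : nat) : Prop :=
  (exists2 c : seq T, simple_cycle e c & size c = g) /\
  (forall c : seq T, simple_cycle e c -> (g <= size c)%N).

(* Main.v *)
(* (b) If x + w = y + z modulo q for block-columns with {x, w} and {y, z}
   disjoint, then the walk through the block-columns x, y, w, z that alternates
   between two fixed block-rows closes up into an 8-cycle.  So the remaining
   block-columns form a Sidon set modulo q, and their differences give
   t (t - 1) <= q - 1.

   (a) If x + z = 2 y, the first three block-rows similarly yield a 6-cycle, so
   the remaining block-columns contain no three-term arithmetic progression, and
   Roth's density increment argument applies.  Let A have s elements in [0, N)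
   and no such progression, and let f = N 1_A - s.  Since A x A has at least s^2/2
   pairs with an integral midpoint but only s of them have their midpoint in A,
   some exponential sum of f is of order s^2.  By the pigeonhole principle its
   phase is almost periodic with some small period d, so A has density at least
   delta + c delta^2 on a progression of difference d and of length about a
   power of N.  Each such step decreases 1 / delta by a constant, so
   O(1 / delta) steps suffice: this is the bound delta = O(1 / log log N). *)

Require Import Defs.
From HB Require Import structures.
From mathcomp Require Import all_boot all_order all_algebra all_field.
From mathcomp Require Import fingroup perm reals exp.
From mathcomp Require Import zify ring lra.

Set Implicit Arguments.
Unset Strict Implicit.
Unset Printing Implicit Defensive.

Import Order.TTheory GRing.Theory Num.Theory.
Local Open Scope ring_scope.

(** * Fourier analysis on an interval *)

Lemma sum_unity_root (n : nat) (z : algC) :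
  z ^+ n = 1 -> z != 1 -> \sum_(k < n) z ^+ k = 0.
Proof.
move=> zn z1; apply: (mulfI (x := z - 1)); first by rewrite subr_eq0.
by rewrite -subrX1 zn subrr mulr0.
Qed.

Lemma norm_prim_root (n : nat) (w : algC) : n.-primitive_root w -> `|w| = 1.
Proof.
move=> wP; have n0 := prim_order_gt0 wP.
by apply/eqP; rewrite -(pexpr_eq1 n0) // -normrX (prim_expr_order wP) normr1.
Qed.

Lemma prim_root_sum (n i j : nat) (w : algC) :
  n.-primitive_root w -> (i < n)%N -> (j < n)%N ->
  \sum_(k < n) (w ^+ i / w ^+ j) ^+ k = if i == j then n%:R else 0.
Proof.
move=> wP lin ljn.
have w0 : w != 0 by rewrite -normr_eq0 (norm_prim_root wP) oner_eq0.
have wj0 : w ^+ j != 0 by rewrite expf_neq0.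
case: eqVneq => [->|neij].
  rewrite mulfV //; under eq_bigr do rewrite expr1n.
  by rewrite sumr_const card_ord.
apply: sum_unity_root.
  rewrite expr_div_n -!exprM ![(_ * n)%N]mulnC !exprM.
  by rewrite (prim_expr_order wP) !expr1n divr1.
apply: contra neij => /eqP e1.
have : w ^+ i == w ^+ j by rewrite -[w ^+ i](divfK wj0) e1 mul1r.
by rewrite (eq_prim_root_expr wP) !modn_small.
Qed.

(** Expanding the square leaves the diagonal by orthogonality; [N <= n] keeps distinct [x < N]
    distinct modulo [n]. *)
Lemma parseval (n N : nat) (w : algC) (a : nat -> bool) :
  n.-primitive_root w -> (N <= n)%N ->
  \sum_(k < n) `|\sum_(x < N) (a x)%:R * (w ^+ x) ^+ k| ^+ 2 =
  (n * \sum_(x < N) a x)%:R.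
Proof.
move=> wP leNn; have w1 := norm_prim_root wP.
transitivity (\sum_(k < n) \sum_(x < N) \sum_(z < N)
    (a x)%:R * (a z)%:R * (w ^+ x / w ^+ z) ^+ k).
  apply: eq_bigr => k _; rewrite normCK rmorph_sum mulr_suml.
  apply: eq_bigr => x _; rewrite mulr_sumr; apply: eq_bigr => z _.
  rewrite rmorphM /= conjC_nat expr_div_n.
  have -> : ((w ^+ z) ^+ k)^* = ((w ^+ z) ^+ k)^-1.
    by rewrite [RHS]invC_norm !normrX w1 !expr1n invr1 mul1r.
  by ring.
rewrite exchange_big natrM natr_sum mulr_sumr; apply: eq_bigr => x _.
rewrite exchange_big (bigD1 x) //= [X in _ + X]big1 ?addr0.
  rewrite -mulr_sumr (prim_root_sum wP) ?eqxx ?(leq_trans (ltn_ord x)) //.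
  by case: (a x); rewrite ?mul0r ?mulr0 ?mul1r ?mulr1.
move=> z zx; rewrite -mulr_sumr (prim_root_sum wP) ?(leq_trans (ltn_ord _)) //.
by rewrite (inj_eq val_inj) eq_sym (negPf zx) mulr0.
Qed.

(** Circle method modulo [n]: the sum is the mean over [k] of [S k ^+ 2 * G k], where [G k] has norm
    at most [B] and the mean of |S k|^2 is the size of [a] by Parseval. *)
Lemma midpoint_sum_le (N : nat) (a : nat -> bool) (f : nat -> algC) (B : algC) :
  (forall u : algC, `|u| = 1 -> `|\sum_(y < N) f y * u ^+ y| <= B) ->
  `|\sum_(x < N) \sum_(z < N) \sum_(y < N)
      (if (x + z == y.*2)%N then (a x)%:R * (a z)%:R * f y else 0)|
  <= B * (\sum_(x < N) a x)%:R.
Proof.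
(* The modulus exceeds 2 (N - 1), so x + z = 2 y modulo n is an equality in nat. *)
move=> fB; set n := N.*2.+1.
have [w wP] := C_prim_root_exists (isT : (0 < n)%N).
have w1 := norm_prim_root wP.
have n0 : 0 < n%:R :> algC by rewrite ltr0n.
set T := (X in `|X|).
pose S k := \sum_(x < N) (a x)%:R * (w ^+ x) ^+ k.
pose G k := \sum_(y < N) f y * ((w ^+ k) ^- 2) ^+ y.
have GB k : `|G k| <= B by apply: fB; rewrite normfV !normrX w1 !expr1n invr1.
have nT : n%:R * T = \sum_(k < n) S k ^+ 2 * G k.
  transitivity (\sum_(k < n) \sum_(x < N) \sum_(z < N) \sum_(y < N)
     (a x)%:R * (a z)%:R * f y * (w ^+ (x + z) / w ^+ y.*2) ^+ k); last first.
    apply: eq_bigr => k _; rewrite expr2 -mulrA mulr_suml; apply: eq_bigr => x _.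
    rewrite mulr_suml mulr_sumr; apply: eq_bigr => z _.
    rewrite !mulr_sumr; apply: eq_bigr => y _.
    rewrite exprD expr_div_n exprMn exprVn -!exprM.
    by rewrite -!mul2n [(2 * y * k)%N]mulnAC [(k * 2)%N]mulnC; ring.
  rewrite [RHS]exchange_big mulr_sumr; apply: eq_bigr => x _.
  rewrite [RHS]exchange_big mulr_sumr; apply: eq_bigr => z _.
  rewrite [RHS]exchange_big mulr_sumr; apply: eq_bigr => y _.
  have := ltn_ord x; have := ltn_ord y; have := ltn_ord z => lz ly lx.
  rewrite -mulr_sumr (prim_root_sum wP) /n; try lia.
  by case: ifP => _; rewrite ?mulr0 // mulrC.
rewrite -(ler_pM2l n0) -[X in X * `|T|](normr_nat algC n) -normrM nT.
apply: le_trans (ler_norm_sum _ _ _) _.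
apply: (le_trans (y := \sum_(k < n) B * `|S k| ^+ 2)).
  by apply: ler_sum => k _; rewrite normrM normrX mulrC ler_wpM2r ?exprn_ge0.
rewrite -mulr_sumr (parseval _ wP); last by rewrite /n; lia.
by rewrite natrM mulrCA.
Qed.

Definition ap3_free (N : nat) (a : nat -> bool) : Prop :=
  forall x y z, (x < N)%N -> (y < N)%N -> (z < N)%N ->
    a x -> a y -> a z -> (x + z = y.*2)%N -> x = z.

Lemma ap3_free_count (N : nat) (a : nat -> bool) : ap3_free N a ->
  (\sum_(x < N) \sum_(z < N) \sum_(y < N)
     (if x + z == y.*2 then a x * a z * a y else 0) <= \sum_(x < N) a x)%N.
Proof.
move=> aP; apply: leq_sum => x _.
rewrite (bigD1 x) //= [X in (_ + X)%N]big1 ?addn0.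
  rewrite (bigD1 x) //= addnn eqxx big1 ?addn0; first by case: (a x).
  by move=> y yx; rewrite (inj_eq double_inj) (inj_eq val_inj) eq_sym (negPf yx).
move=> z zx; apply: big1 => y _; case: eqP => // xzy.
case ax: (a x) => //; case az: (a z) => //; case ay: (a y) => //.
by case/eqP: zx; apply/val_inj/esym/(aP x y z).
Qed.

(** A pair has an integral midpoint exactly when its entries have the same parity; with p even and
    p' odd elements, 2 (p^2 + p'^2) >= (p + p')^2. *)
Lemma same_parity_count (N : nat) (a : nat -> bool) :
  ((\sum_(x < N) a x) ^ 2 <=
   2 * \sum_(x < N) \sum_(z < N) \sum_(y < N)
     (if x + z == y.*2 then a x * a z else 0))%N.
Proof.
rewrite -lez_nat; set s := (\sum_(x < N) a x)%N.
(* 2 [x + z even] = 1 + (-1)^x (-1)^z *)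
pose e : int := \sum_(x < N) (-1) ^+ x * (a x : nat)%:Z.
have -> : Posz (s ^ 2) = s%:Z ^+ 2 by rewrite -!natz natrX.
apply: (@le_trans _ _ (s%:Z ^+ 2 + e ^+ 2)); first by rewrite lerDl sqr_ge0.
have sE : s%:Z = \sum_(x < N) (a x : nat)%:Z.
  by rewrite /s -natz natr_sum; apply: eq_bigr => x _; rewrite natz.
rewrite PoszM -[X in _ * X]natz natr_sum mulr_sumr sE !expr2 !mulr_suml -big_split.
apply: ler_sum => x _ /=; rewrite natr_sum !mulr_sumr -big_split.
apply: ler_sum => z _ /=; rewrite natr_sum mulr_sumr.
have [ev|od] := boolP (odd (x + z)).
  rewrite (_ : _ + _ = 0); first by apply: sumr_ge0 => y _; case: ifP => //; lia.
  rewrite mulrACA -exprD -[X in _ + X * _]signr_odd ev expr1; lia.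
have yP : (((x + z)./2) < N)%N by have := ltn_ord x; have := ltn_ord z; lia.
rewrite (bigD1 (Ordinal yP)) //= ifT; last by lia.
rewrite mulrACA -exprD -[X in _ + X * _]signr_odd (negPf od) expr0 mul1r natz.
rewrite [X in X <= _](_ : _ = 2 * (a x * a z)%N%:Z); last by lia.
by rewrite lerDl; apply: sumr_ge0 => y _; case: ifP => //; lia.
Qed.

(** The sum inside the norm is N T - s E, where [T] counts progressions and [E] pairs with a
    midpoint, so that T <= s and 2 E >= s^2. *)
Lemma ap3_free_balanced_sum (N s : nat) (a : nat -> bool) :
  ap3_free N a -> s = (\sum_(x < N) a x)%N ->
  s%:Z ^+ 3 - 2 * N%:Z * s%:Z <= 2 * `|\sum_(x < N) \sum_(z < N) \sum_(y < N)
     (if (x + z == y.*2)%N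
      then (a x)%:R * (a z)%:R * (N%:Z * (a y)%:R - s%:Z) else 0)|.
Proof.
move=> aP sE; have cT := ap3_free_count aP; have cE := same_parity_count N a.
set T := (X in (X <= _)%N) in cT; set E := (X in (2 * X)%N) in cE.
set L := (X in `|X|).
have -> : L = N%:Z * T%:Z - s%:Z * E%:Z.
  rewrite -[T%:Z]natz -[E%:Z]natz !natr_sum !mulr_sumr -sumrB; apply: eq_bigr => x _.
  rewrite !natr_sum !mulr_sumr -sumrB; apply: eq_bigr => z _.
  rewrite !natr_sum !mulr_sumr -sumrB; apply: eq_bigr => y _.
  by case: ifP => _; rewrite ?mulr0 ?subr0 // !natrM; ring.
rewrite -sE in cT cE; have : s%:Z ^+ 2 <= 2 * E%:Z by lia.
have : T%:Z <= s%:Z by lia.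
have : (0 <= N%:Z) by []. have : 0 <= s%:Z by [].
move: (s%:Z) (T%:Z) (E%:Z) (N%:Z) => {}s {cT}T {cE}E {L aP sE}N s0 N0 Ts sE.
have : N * T <= N * s by rewrite ler_wpM2l.
have : s * s ^+ 2 <= s * (2 * E) by rewrite ler_wpM2l.
rewrite (exprS s 2); lia.
Qed.

(** * Roth's density increment *)

Lemma eq_floor_dist (x y : algC) : x \is Num.real -> y \is Num.real ->
  Num.floor x = Num.floor y -> `|x - y| <= 1.
Proof.
move=> xR yR e; have /andP[xl xu] := real_floor_itv xR.
have /andP[yl yu] := real_floor_itv yR; rewrite -e intrD in yl yu.
rewrite intrD in xu.
have le1 (r s : algC) n : r < n%:~R + 1 -> n%:~R <= s -> r - s <= 1.
  by move=> rn ns; rewrite lerBlDl (le_trans (ltW rn)) // lerD2r.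
by rewrite real_ler_norml ?rpredB // lerNl opprB !(le1 _ _ (Num.floor x)).
Qed.

Lemma norm_le_Re_Im (z : algC) : `|z| <= `|'Re z| + `|'Im z|.
Proof.
rewrite {1}[z]Crect; apply: le_trans (ler_normD _ _) _.
by rewrite normrM normCi mul1r.
Qed.

(** The floor lies between -m and m, so that shifting it by [m] gives one of 2m + 1 box indices. *)
Lemma floor_scaled_bound (m : nat) (x : algC) : x \is Num.real -> `|x| <= 1 ->
  (`|(Num.floor (m%:R * x) + m%:Z)%R|%N < m.*2.+1)%N.
Proof.
move=> xR; rewrite real_ler_norml // => /andP[x1 x2].
have mxR : m%:R * x \is Num.real by rewrite rpredM ?realn.
have : (- m%:Z <= Num.floor (m%:R * x)).
  by rewrite real_floor_ge_int // mulrNz -pmulrn -mulrN1 ler_wpM2l.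
have : (Num.floor (m%:R * x) < m%:Z + 1).
  rewrite real_floor_lt_int //.
  rewrite intrD -pmulrn; apply: (@le_lt_trans _ _ m%:R); last by rewrite ltrDl.
  by rewrite -[leRHS]mulr1 ler_wpM2l.
lia.
Qed.

(* Pigeonhole: the powers of u fall into (2m + 1)^2 boxes of side 1/m. *)
Lemma unit_near_return (m : nat) (u : algC) : (0 < m)%N -> `|u| = 1 ->
  exists2 d, (0 < d <= m.*2.+1 ^ 2)%N & m%:R * `|u ^+ d - 1| <= 2.
Proof.
move=> m0 u1.
pose box (x : algC) := inord `|(Num.floor (m%:R * x) + m%:Z)%R|%N : 'I_(m.*2.+1).
pose b (i : 'I_(m.*2.+1 ^ 2).+1) := (box ('Re (u ^+ i)), box ('Im (u ^+ i))).
have un i : `|u ^+ i| = 1 by rewrite normrX u1 expr1n.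
have ReB i : `|'Re (u ^+ i)| <= 1 by rewrite -(un i) leif_normC_Re_Creal.
have ImB i : `|'Im (u ^+ i)| <= 1.
  rewrite -(@ler_sqr _ _ 1) ?nnegrE // expr1n real_normK ?Creal_Im //.
  rewrite -[leRHS](expr1n _ 2) -(un i) normC2_Re_Im lerDr.
  by rewrite -real_normK ?Creal_Re // exprn_ge0.
have boxP (x y : algC) : x \is Num.real -> y \is Num.real -> `|x| <= 1 -> `|y| <= 1 ->
    box x = box y -> m%:R * `|x - y| <= 1.
  move=> xR yR x1 y1 /(congr1 val); rewrite /= !inordK ?floor_scaled_bound //.
  move=> e; rewrite -[m%:R]normr_nat -normrM mulrBr.
  apply: eq_floor_dist; rewrite ?rpredM ?realn //.
  have fge (z : algC) : z \is Num.real -> `|z| <= 1 -> 0 <= Num.floor (m%:R * z) + m%:Z.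
    move=> zR; rewrite real_ler_norml // => /andP[z1 _].
    rewrite -lerBlDr sub0r real_floor_ge_int ?rpredM ?realn //.
    by rewrite mulrNz -pmulrn -mulrN1 ler_wpM2l.
  by apply: (addIr m%:Z); rewrite -(gez0_abs (fge x xR x1)) e gez0_abs ?fge.
have /injectivePn[i [j neij]] : ~~ injectiveb b.
  apply/injectiveP => /leq_card; rewrite card_prod !card_ord; lia.
wlog ltij : i j neij / (i < j)%N.
  move=> H e; case: (ltngtP i j) => [lt|lt|/val_inj eq].
  - exact: (H i j).
  - by apply: (H j i) => //; rewrite eq_sym.
  - by rewrite eq eqxx in neij.
move=> [eR eI]; exists (j - i)%N; first by have := ltn_ord j; lia.
have -> : `|u ^+ (j - i) - 1| = `|u ^+ j - u ^+ i|.
  have -> : u ^+ j - u ^+ i = u ^+ i * (u ^+ (j - i) - 1).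
    by rewrite mulrBr mulr1 -exprD subnKC // ltnW.
  by rewrite normrM un mul1r.
(* Two points of one box differ by at most 1/m in each coordinate, whence the constant 2. *)
rewrite distrC; apply: (@le_trans _ _ (1 + 1)); last by [].
apply: (le_trans (ler_wpM2l (ler0n _ _) (norm_le_Re_Im _))).
rewrite mulrDr !raddfB /=; apply: lerD; apply: boxP;
  rewrite ?Creal_Re ?Creal_Im //.
Qed.

(** * Exponential sums cut into short progressions *)

Lemma norm_sum_nat_le (R : numDomainType) (g : nat -> R) (K : R) (m n p : nat) :
  (forall x, (x < p)%N -> `|g x| <= K) -> (m <= n <= p)%N ->
  `|\sum_(m <= x < n) g x| <= (n - m)%:R * K.
Proof.
move=> gK /andP[mn np]; apply: le_trans (ler_norm_sum _ _ _) _.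
rewrite mulr_natl -sumr_const_nat big_nat [leRHS]big_nat.
by apply: ler_sum => i /andP[_ i2]; apply: gK; apply: leq_trans np.
Qed.

(** For each [l], the shift of [0, n) by [l * d] misses [L * d] points of [0, n + L d): [l * d] on
    the left and the rest on the right. Each costs at most [K]. *)
Lemma window_sum (R : numDomainType) (g : nat -> R) (K : R) (n L d : nat) :
  (forall x, (x < n + L * d)%N -> `|g x| <= K) ->
  `|L%:R * \sum_(x < n + L * d) g x - \sum_(x < n) \sum_(l < L) g (x + l * d)%N|
  <= L%:R * ((L * d)%:R * K).
Proof.
move=> gK.
rewrite exchange_big !mulr_natl -[L in _ *+ L]card_ord -sumr_const -sumrB.
apply: le_trans (ler_norm_sum _ _ _) _.
rewrite -[X in _ <= _ *+ X]card_ord -sumr_const; apply: ler_sum => l _.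
have lL := ltn_ord l.
have ldL : (l * d <= L * d)%N by rewrite leq_mul2r (ltnW lL) orbT.
rewrite -(big_mkord xpredT) (big_cat_nat (n := (l * d)%N)) //=; last by lia.
rewrite (big_cat_nat (m := (l * d)%N) (n := (n + l * d)%N)) //=; try lia.
rewrite [X in _ + (X + _)](_ : _ = \sum_(x < n) g (x + l * d)%N); last first.
  by rewrite -{1}[(l * d)%N]add0n big_addn addnK big_mkord.
rewrite addrCA addrAC subrr add0r; apply: le_trans (ler_normD _ _) _.
apply: le_trans (lerD (norm_sum_nat_le gK _) (norm_sum_nat_le gK _)) _; try lia.
by rewrite -mulrDl -natrD subn0 subnDl subnKC // mulr_natl.
Qed.

Lemma norm_subX1_le (u : algC) (l : nat) :
  `|u| = 1 -> `|u ^+ l - 1| <= l%:R * `|u - 1|.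
Proof.
move=> u1; rewrite subrX1 normrM mulrC ler_wpM2r //.
apply: le_trans (ler_norm_sum _ _ _) _.
under eq_bigr do rewrite normrX u1 expr1n.
by rewrite sumr_const card_ord.
Qed.

(** Along the progression the phase hardly turns: [u ^+ x] factors out, and [u ^+ (l * d)] is within
    2 l / m of 1. *)
Lemma norm_twisted_sum_le (f : nat -> int) (K m L d x : nat) (u : algC) :
  `|u| = 1 -> m%:R * `|u ^+ d - 1| <= 2 ->
  (forall l, (l < L)%N -> `|f (x + l * d)%N| <= K%:Z) ->
  m%:R * `|\sum_(l < L) (f (x + l * d)%N)%:~R * u ^+ (x + l * d)|
  <= m%:R * (`|\sum_(l < L) f (x + l * d)%N|)%:~R + 2 * (L ^ 2 * K)%:R.
Proof.
move=> u1 ud fK; set W := \sum_(l < L) f _.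
have -> : \sum_(l < L) (f (x + l * d)%N)%:~R * u ^+ (x + l * d) =
  u ^+ x * (W%:~R + \sum_(l < L) (f (x + l * d)%N)%:~R * ((u ^+ d) ^+ l - 1)).
  rewrite raddf_sum -big_split mulr_sumr; apply: eq_bigr => l _ /=.
  by rewrite exprD [(l * d)%N]mulnC exprM; ring.
rewrite normrM normrX u1 expr1n mul1r intr_norm.
apply: le_trans (ler_wpM2l (ler0n _ _) (ler_normD _ _)) _.
rewrite mulrDr lerD2l.
apply: le_trans (ler_wpM2l (ler0n _ _) (ler_norm_sum _ _ _)) _.
rewrite mulr_sumr; apply: (@le_trans _ _ (\sum_(l < L) 2 * (L * K)%:R)).
  apply: ler_sum => l _; rewrite normrM mulrCA.
  have lL := ltn_ord l; have := fK l lL.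
  rewrite -(ler_int algC) intr_norm => fl.
  apply: (@le_trans _ _ (K%:R * (l%:R * 2))).
    apply: ler_pM => //; first by rewrite mulr_ge0.
    apply: le_trans (ler_wpM2l (ler0n _ _) (norm_subX1_le _ _)) _.
      by rewrite normrX u1 expr1n.
    by rewrite mulrCA ler_wpM2l.
  by rewrite -!natrM ler_nat; nia.
by rewrite sumr_const card_ord -[X in X <= _]mulr_natr -!natrM ler_nat; nia.
Qed.

(** A one-sided bound controls absolute values, because the window sums cancel in total up to the
    boundary error of [window_sum]. *)
Lemma balanced_windows (f : nat -> int) (K c t n L d : nat) :
  (forall x, (x < n + L * d)%N -> `|f x| <= K%:Z) ->
  \sum_(x < n + L * d) f x = 0 ->
  (forall x, (x < n)%N -> t%:Z * \sum_(l < L) f (x + l * d)%N <= c%:Z) ->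
  t%:Z * \sum_(x < n) `|\sum_(l < L) f (x + l * d)%N|
  <= (2 * c * n + t * (L * (L * d) * K))%N%:Z.
Proof.
move=> fK f0 fc; have := window_sum fK; rewrite f0 mulr0 sub0r normrN.
set W := \sum_(x < n) _; rewrite !natz -!PoszM => Wle.
(* Each window sum W satisfies |W| = 2 max(W, 0) - W. *)
apply: (@le_trans _ _
  (\sum_(x < n) ((2 * c)%N%:Z - t%:Z * \sum_(l < L) f (x + l * d)%N))).
  rewrite mulr_sumr; apply: ler_sum => x _; have := fc x (ltn_ord x).
  by case: (ler0P (\sum_(l < L) f (x + l * d)%N)); nia.
rewrite sumrB -mulr_sumr -/W sumr_const card_ord.
have : t%:Z * - W <= t%:Z * (L * (L * d) * K)%N by apply: ler_wpM2l => //; lia.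
rewrite -mulr_natr natz; lia.
Qed.

(** The three terms come from the excess c / t allowed to each window, the boundary errors (once for
    [f], once for the exponential sum) and the drift of the phase. Denominators are multiplied
    out. *)
Lemma exp_sum_le (f : nat -> int) (K c t m n L d : nat) (u : algC) :
  `|u| = 1 -> m%:R * `|u ^+ d - 1| <= 2 ->
  (forall x, (x < n + L * d)%N -> `|f x| <= K%:Z) ->
  \sum_(x < n + L * d) f x = 0 ->
  (forall x, (x < n)%N -> t%:Z * \sum_(l < L) f (x + l * d)%N <= c%:Z) ->
  (t * m * L)%:R * `|\sum_(x < n + L * d) (f x)%:~R * u ^+ x|
  <= (2 * (c * n * m + t * m * L ^ 2 * d * K + t * n * L ^ 2 * K))%:R.
Proof.
move=> u1 ud fK f0 fc; have bW := balanced_windows fK f0 fc.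
set F := \sum_(x < _) _ * _.
pose g x := (f x)%:~R * u ^+ x.
have gK x : (x < n + L * d)%N -> `|g x| <= K%:R.
  move=> /fK; rewrite normrM normrX u1 expr1n mulr1.
  by rewrite -(ler_int algC) intr_norm.
have := window_sum gK; rewrite -/F; set G := \sum_(x < n) _ => FG.
have Gle : m%:R * `|G| <= m%:R * (\sum_(x < n) `|\sum_(l < L) f (x + l * d)%N|)%:~R
     + n%:R * (2 * (L ^ 2 * K)%:R).
  apply: le_trans (ler_wpM2l (ler0n _ _) (ler_norm_sum _ _ _)) _.
  have -> : n%:R * (2 * (L ^ 2 * K)%:R) = \sum_(x < n) 2 * (L ^ 2 * K)%:R :> algC.
    by rewrite sumr_const card_ord [LHS]mulr_natl.
  rewrite raddf_sum !mulr_sumr -big_split.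
  apply: ler_sum => x _; apply: norm_twisted_sum_le => // l lL; apply: fK.
  have := ltn_ord x; nia.
have LF : L%:R * `|F| <= (L * (L * d) * K)%:R + `|G|.
  rewrite -[L%:R]normr_nat -normrM -[_ * F](subrK G) (le_trans (ler_normD _ _)) //.
  by rewrite lerD2r (le_trans FG) // -!natrM mulnA.
move: bW; rewrite -(ler_int algC) intrM => bW.
have -> : (t * m * L)%:R * `|F| = (t * m)%:R * (L%:R * `|F|) by rewrite natrM mulrA.
apply: le_trans (ler_wpM2l (ler0n _ _) LF) _.
rewrite mulrDr natrM -[_ * `|G|]mulrA.
apply: le_trans (lerD (lexx _) (ler_wpM2l (ler0n _ _) Gle)) _.
rewrite mulrDr mulrCA.
apply: le_trans (lerD (lexx _) (lerD (ler_wpM2l (ler0n _ _) bW) (lexx _))) _.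
rewrite -pmulrn -!natrM -!natrD ler_nat; nia.
Qed.

Lemma sum_bool_le (n : nat) (b : nat -> bool) : (\sum_(x < n) b x <= n)%N.
Proof.
by rewrite -[leqRHS]card_ord -sum1_card; apply: leq_sum => x _; case: (b x).
Qed.

(** The last hypothesis is what the two bounds on the midpoint sum give when no progression is
    denser. The choice of [m] makes the phase drift L / m at most the squared density over 289, and
    m^3 <= N keeps the boundary error within a constant factor of that. Divided by L^2 and by t (t +
    1)^2 s^2, the right side is at most 42/289 + (4/17)(1 + 1/t) < 1. *)
Lemma increment_arith (N t L s m : nat) : m = (L * t.+1 ^ 2)%N ->
  (16 <= t)%N -> (0 < L)%N -> (L ^ 3 * t.+1 ^ 6 <= N)%N -> (17 * N <= t.+1 * s)%N ->
  (t * m * L * s ^ 2 <= t * m * L * (2 * N) +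
     2 * (2 * (s * L * N * m + t * m * L ^ 2 * m.*2.+1 ^ 2 * N + t * N * L ^ 2 * N)))%N ->
  False.
Proof.
move=> mE t16 L0 LN sN.
have r0 : (0 < t.+1 ^ 2)%N by rewrite expn_gt0.
have mN : (m ^ 3 <= N)%N by rewrite mE expnMn -expnM.
have m0 : (0 < m)%N by rewrite mE muln_gt0 L0.
have rN : (t.+1 ^ 2 <= N)%N.
  apply: leq_trans mN; rewrite mE; move: (t.+1 ^ 2)%N r0 => r r0.
  apply: (@leq_trans (L * r)%N); first by rewrite leq_pmull.
  by rewrite -[X in (X <= _)%N]expn1 leq_pexp2l // muln_gt0 L0.
have mD : (m * m.*2.+1 ^ 2 <= 9 * N)%N.
  apply: (@leq_trans (m * (3 * m) ^ 2)%N).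
    by rewrite leq_mul2l leq_exp2r //; clear -m0; lia.
  by rewrite expnMn mulnCA -expnS leq_mul2l mN.
have sq : (289 * (N * N) <= t.+1 ^ 2 * s ^ 2)%N.
  by have := leq_mul sN sN; rewrite -expnMn expnS expn1; clear; lia.
have cr : (17 * (s * N) <= t.+1 * s ^ 2)%N.
  by have := leq_mul (leqnn s) sN; rewrite [(s ^ 2)%N]expnS expn1; clear; lia.
move: (t.+1 ^ 2)%N (m.*2.+1 ^ 2)%N mE r0 rN sq mD {mN m0 LN sN} => r D mE r0 rN sq mD H.
have {H} : (L ^ 2 * (t * (r * s ^ 2)) <=
            L ^ 2 * (2 * (t * (r * N)) + 4 * (r * (s * N)) + 40 * (t * (N * N))))%N.
  have := leq_mul (leqnn (4 * t * L ^ 2 * N)) mD.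
  move: H; rewrite mE [(L ^ 2)%N]expnS expn1; clear; lia.
rewrite leq_pmul2l ?expn_gt0 ?L0 // => H.
have rNN : (t * (r * N) <= t * (N * N))%N by rewrite leq_mul2l leq_mul2r rN !orbT.
have := leq_mul (leqnn r) cr; have := leq_mul (leqnn t) sq.
rewrite (mulnCA r t.+1) (mulnCA r 17%N).
have : (0 < r * s ^ 2)%N.
  by apply: leq_trans sq; rewrite !muln_gt0 !(leq_trans r0 rN).
have : (16 * (r * s ^ 2) <= t * (r * s ^ 2))%N by rewrite leq_mul2r t16 orbT.
move: H rNN; rewrite (mulSn t).
rewrite (mulnCA t 289%N).
move: (r * s ^ 2)%N (r * (s * N))%N => Y Z; clear.
move: (t * Y)%N (t * (N * N))%N (t * (r * N))%N => ? ? ?; lia.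
Qed.

(* With u = N / |A|, this passes from u <= (t + 1) / 17 to u <= t / 17. *)
Lemma density_increment (N t L : nat) (a : nat -> bool) :
  (16 <= t)%N -> (0 < L)%N -> (L ^ 3 * t.+1 ^ 6 <= N)%N -> ap3_free N a ->
  (17 * N <= t.+1 * \sum_(x < N) a x)%N ->
  exists2 b, ap3_free L b & (17 * L <= t * \sum_(x < L) b x)%N.
Proof.
move=> t16 L0 LN aP; set s := (\sum_(x < N) a x)%N => sN.
move mE: (L * t.+1 ^ 2)%N => m; move DE: (m.*2.+1 ^ 2)%N => D.
(* Either some progression of [L] terms, with a difference in the range of [unit_near_return], is
   dense and its rescaling serves as [b], or [no] leads to a contradiction. *)
have [|no] := boolP [exists d : 'I_D.+1, exists x : 'I_N,
    [&& 0 < d, x + L * d <= N & 17 * L <= t * \sum_(l < L) a (x + l * d)]%N].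
  case/existsP => d /existsP[x /and3P[d0 xN dense]].
  exists (fun l => a (x + l * d)%N) => // i j k iL jL kL ai aj ak ijk.
  have lt l : (l < L)%N -> (x + l * d < N)%N.
    by move=> lL; apply: leq_trans xN; rewrite ltn_add2l ltn_pmul2r.
  apply/eqP; rewrite -(eqn_pmul2r d0) -(eqn_add2l x); apply/eqP.
  apply: aP (lt i iL) (lt j jL) (lt k kL) ai aj ak _.
  by rewrite addnACA -mulnDl ijk addnn doubleD doubleMl.
have sleN : (s <= N)%N by apply: sum_bool_le.
have s0 : (0 < s)%N.
  have : (0 < N)%N by apply: leq_trans LN; rewrite muln_gt0 !expn_gt0 L0.
  by clear -sN; case: s sN => //; rewrite muln0; clear; lia.
have m0 : (0 < m)%N by rewrite -mE muln_gt0 L0 expn_gt0.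
pose f x : int := N%:Z * (a x)%:R - s%:Z.
(* The bound of [exp_sum_le] with K = N and c = s L, made uniform in d <= D and n <= N. *)
pose b := (2 * (s * L * N * m + t * m * L ^ 2 * D * N + t * N * L ^ 2 * N))%N.
have tmL0 : 0 < (t * m * L)%:R :> algC by rewrite ltr0n !muln_gt0 m0 L0 (leq_trans _ t16).
have F (u : algC) : `|u| = 1 ->
    `|\sum_(y < N) (f y)%:~R * u ^+ y| <= b%:R / (t * m * L)%:R.
  move=> u1; rewrite ler_pdivlMr // mulrC.
  have [d /andP[d0 dD] ud] := unit_near_return m0 u1; rewrite DE in dD.
  (* The windows fit: d <= 9 m^2 <= (t + 1)^2 m^2, and L (t + 1)^2 m^2 = L^3 (t + 1)^6 <= N. *)
  have LdN : (L * d <= N)%N.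
    apply: leq_trans LN; rewrite (@leq_trans (L * (3 * m) ^ 2)%N) //.
      rewrite leq_mul2l (leq_trans dD) ?orbT // -DE leq_exp2r //.
      by clear -m0; lia.
    have -> : (L ^ 3 * t.+1 ^ 6 = L * (t.+1 ^ 2 * m ^ 2))%N.
      by rewrite -mE expnMn (mulnCA (t.+1 ^ 2)%N) -expnM -expnD mulnA -expnS.
    have r9 : (9 <= t.+1 ^ 2)%N by rewrite -[9%N]/(3 ^ 2)%N leq_exp2r //; clear -t16; lia.
    by rewrite expnMn leq_mul2l leq_mul2r r9 !orbT.
  have NE : (N - L * d + L * d = N)%N by rewrite subnK.
  have fK x : (x < N - L * d + L * d)%N -> `|f x| <= N%:Z.
    by move=> _; rewrite /f; case: (a x); clear -sleN => /=; lia.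
  have f0 : \sum_(x < N - L * d + L * d) f x = 0.
    rewrite NE /f sumrB -mulr_sumr sumr_const card_ord -natr_sum -/s natz -mulr_natr natz.
    by rewrite mulrC subrr.
  (* A window with [w] elements has t w < 17 L; together with 17 N <= (t + 1) s this gives t (N w -
     s L) <= s L. *)
  have fc x : (x < N - L * d)%N ->
      t%:Z * \sum_(l < L) f (x + l * d)%N <= (s * L)%N%:Z.
    move=> xN; rewrite /f sumrB -mulr_sumr sumr_const card_ord -natr_sum -mulr_natr !natz.
    move: no; rewrite negb_exists => /forallP/(_ (Ordinal (dD : (d < D.+1)%N))).
    have xN' : (x < N)%N by clear -xN; lia.
    rewrite negb_exists => /forallP/(_ (Ordinal xN')) /=.
    rewrite d0 (_ : x + L * d <= N)%N /=; last by clear -xN; lia.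
    rewrite -ltnNge; move: (\sum_(l < L) _)%N => w tw.
    have := leq_mul (leqnn N) (ltnW tw); have := leq_mul (leqnn L) sN.
    clear; nia.
  have := exp_sum_le u1 ud fK f0 fc; rewrite NE => /le_trans; apply.
  rewrite ler_nat /b leq_mul2l !leq_add ?leq_mul ?leq_subr //.
have := midpoint_sum_le a (f := fun y => (f y)%:~R) F; rewrite -/s.
have := ap3_free_balanced_sum aP erefl; rewrite -/s.
set T := \sum_(x < N) _; set T' := \sum_(x < N) _ => le1.
have -> : T' = T%:~R.
  rewrite raddf_sum; apply: eq_bigr => x _; rewrite raddf_sum; apply: eq_bigr => z _.
  rewrite raddf_sum; apply: eq_bigr => y _; case: ifP => // _.
  by rewrite /= [RHS]rmorphM rmorphM !rmorph_nat.
rewrite -intr_norm mulrAC ler_pdivlMr // -!natrM ler_nat => le2.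
exfalso; apply: (@increment_arith N t L s m) => //.
(* Both [le1] and [le2] carry a factor [s]; it is cancelled to reach the form of
   [increment_arith]. *)
rewrite -(leq_pmul2l s0) DE -/b.
have {}le1 : (s ^ 3 <= 2 * N * s + 2 * `|T|)%N.
  by move: le1; rewrite (_ : s%:Z ^+ 3 = (s ^ 3)%N%:Z) -?natz ?natrX //; lia.
have := leq_mul (leqnn (t * m * L)) le1.
move: (t * m * L)%N le2 => c; rewrite (expnS s 2); clear; move: `|T|%N b => A b; nia.
Qed.

(** Iterates the increment, with 17 / t as a lower bound for the density. When N >= L^4 for L =
    2^(4^t), [density_increment] takes L^3 and the remaining factor L absorbs (t + 1)^6. A density
    bound 17 / t with t <= 16 exceeds 1 and leaves only N = 0. *)
Lemma ap3_free_lt (t N : nat) (a : nat -> bool) :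
  ap3_free N a -> (17 * N <= t * \sum_(x < N) a x)%N -> (N < 2 ^ (4 ^ t))%N.
Proof.
elim: t N a => [|t IH] N a aP sN.
  by move: sN; rewrite mul0n leqn0 muln_eq0 /= => /eqP ->.
have [t16|t16] := leqP 16 t; last first.
  have := leq_trans sN (leq_mul (leqnn _) (sum_bool_le N a)).
  have : (t.+1 * N <= 16 * N)%N by rewrite leq_mul2r t16 orbT.
  case: N {aP sN} => [_ _|N]; first by rewrite expn_gt0.
  by clear; lia.
rewrite ltnNge; apply/negP => Nge.
have L0 : (0 < 2 ^ (4 ^ t))%N by rewrite expn_gt0.
have LN : ((2 ^ (4 ^ t)) ^ 3 * t.+1 ^ 6 <= N)%N.
  apply: leq_trans Nge; rewrite (expnS 4 t) (mulnC 4) expnM [leqRHS]expnSr leq_mul2l.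
  (* (t + 1)^6 <= 2^(6 t), and 6 t <= t^2 <= 4^t. *)
  apply/orP; right; apply: (@leq_trans ((2 ^ t) ^ 6)%N).
    by rewrite leq_exp2r // ltn_expl.
  rewrite -expnM leq_exp2l // (expnMn 2 2 t : 4 ^ t = _)%N.
  have := ltn_expl t (isT : (1 < 2)%N); move: (2 ^ t)%N => y ty.
  apply: leq_trans (leq_mul (ltnW ty) (ltnW ty)).
  by rewrite leq_mul2l (leq_trans _ t16) ?orbT.
have [b bP] := density_increment t16 L0 LN aP sN.
by move/(IH _ _ bP); rewrite ltnn.
Qed.

(** Take [t] just above 17 q / s, so that t s <= 18 q. Then q < 2^(4^t) gives ln (ln q) <= t ln 4 <=
    3 t, and 54 = 3 * 18. The division needs ln (ln q) > 0, which holds since q >= 3 > e. *)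
Lemma ap3_free_le (R : realType) (q : nat) (a : nat -> bool) :
  (3 <= q)%N -> ap3_free q a ->
  (\sum_(x < q) a x)%:R <= 54 * q%:R / ln (ln q%:R) :> R.
Proof.
move=> q3 aP; set s := (\sum_(x < q) a x)%N.
have le_ln (x : R) : 0 < x -> ln x <= x - 1.
  by move=> x0; rewrite -[X in ln X](subrKC 1) le_ln1Dx //; lra.
(* e < (6/5)^6 < 3 *)
have lnq1 : 1 < ln q%:R :> R.
  apply: (@le_lt_trans _ _ (ln ((6 / 5) ^+ 6))).
    rewrite lnXn; last by lra.
    by rewrite -[6 / 5]invrK lnV ?posrE; [have := le_ln (6 / 5)^-1; lra|lra].
  rewrite ltr_ln ?posrE; [|lra|by rewrite ltr0n (leq_trans _ q3)].
  by apply: (@lt_le_trans _ _ 3); [lra|rewrite ler_nat].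
have llq0 : 0 < ln (ln q%:R) :> R by rewrite ln_gt0.
rewrite ler_pdivlMr //.
have [->|s0] := posnP s; first by rewrite mul0r mulr_ge0.
pose t := ((17 * q) %/ s).+1.
have sleq : (s <= q)%N by apply: sum_bool_le.
have ts : (t * s <= 18 * q)%N.
  by rewrite /t mulSn; have := leq_trunc_div (17 * q) s; lia.
have lt_q : (q < 2 ^ (4 ^ t))%N.
  by apply: ap3_free_lt aP _; rewrite -/s ltnW // ltn_ceil.
have q0 : 0 < q%:R :> R by rewrite ltr0n; lia.
have lnq : ln q%:R <= 4%:R ^+ t :> R.
  apply: (@le_trans _ _ (ln (2 ^ (4 ^ t))%N%:R)).
    by rewrite ler_ln ?posrE ?ltr0n ?expn_gt0 ?(leq_trans _ q3) // ler_nat ltnW.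
  rewrite natrX lnXn // -natrX -[leRHS]mulr1 -[X in X <= _]mulr_natl ler_wpM2l //.
  by apply: le_trans (le_ln _ _) _ => //; lra.
have : ln (ln q%:R) <= t%:R * 3 :> R.
  apply: (@le_trans _ _ (ln (4%:R ^+ t))).
    by rewrite ler_ln ?posrE ?exprn_gt0 // (lt_trans _ lnq1).
  rewrite lnXn // -[X in X <= _]mulr_natl ler_wpM2l //.
  by apply: le_trans (le_ln _ _) _ => //; lra.
move=> /(ler_wpM2l (ler0n _ s)) /le_trans; apply.
by rewrite mulrA -natrM -!natrM ler_nat; lia.
Qed.

(** * Cycles in the Tanner graph of an array code *)

(** Being circulant, the permutation is the translation by the image of 0. Writing the size as
    [q.+2] gives the index type its ring structure. *)
Lemma circulant_perm_shift (q : nat) (P : 'M['F_2]_q.+2) :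
  nontrivial_circulant_perm P ->
  exists2 s : 'I_q.+2, s != 0 &
    forall k (i j : 'I_q.+2), ((P ^+ k) i j == 1) = (j == i + s *+ k).
Proof.
move=> [cP /is_perm_mxP[p pE] P1].
have pS i : p i = i + p 0.
  have : P i (i + p 0) = P 0 (p 0).
    by apply: cP; rewrite /= addn0 modn_mod addnC.
  by rewrite pE /perm_mx !mxE eqxx /=; case: eqP.
exists (p 0).
  apply: contra P1 => /eqP p0; rewrite pE; apply/eqP/matrixP => i j.
  by rewrite /perm_mx !mxE pS p0 addr0.
elim=> [|k IH] i j.
  by rewrite expr0 mulr0n addr0 mxE [RHS]eq_sym; case: (i == j).
rewrite exprS {1}pE -[perm_mx p * _]row_permE mxE IH pS.
by rewrite mulrS addrA.
Qed.

Lemma array_code_entry (q r : nat) (P : 'M['F_2]_q) (a : 'I_r -> 'I_q)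
    (D : {set 'I_q}) (i : 'I_r) (j : 'I_#|~: D|) (x y : 'I_q) :
  delete_block_cols D (array_pcm P a)
    (tagnat.Rank (p_ := fun=> q) i x) (tagnat.Rank (p_ := fun=> q) j y) =
  (P ^+ (a i * enum_val j)) x y.
Proof.
transitivity (submxrow (delete_block_cols D (array_pcm P a)) j
   (tagnat.Rank (p_ := fun=> q) i x) y); first by rewrite [RHS]mxE.
rewrite /delete_block_cols mxrowK.
transitivity (submxblock (array_pcm P a) i (enum_val j) x y); last by rewrite mxblockK.
by rewrite !mxE.
Qed.

Section TannerCycles.

Variables (q r : nat) (P : 'M['F_2]_q.+2) (a : 'I_r -> 'I_q.+2).
Variable D : {set 'I_q.+2}.

Local Notation e := (tanner (delete_block_cols D (array_pcm P a))).
Local Notation vertex := ('I_(\sum_(j < #|~: D|) q.+2) + 'I_(\sum_(i < r) q.+2))%type.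

Let col (j : 'I_#|~: D|) (y : 'I_q.+2) : vertex :=
  inl (tagnat.Rank (p_ := fun=> q.+2) j y).
Let row (i : 'I_r) (x : 'I_q.+2) : vertex :=
  inr (tagnat.Rank (p_ := fun=> q.+2) i x).

Lemma col_eq j y j' y' : (col j y == col j' y') = (j == j') && (y == y').
Proof. exact: tagnat.eq_Rank. Qed.

Lemma row_eq i x i' x' : (row i x == row i' x') = (i == i') && (x == x').
Proof. exact: tagnat.eq_Rank. Qed.

Hypothesis Pcirc : nontrivial_circulant_perm P.

(** Turns adjacency into a linear equation modulo [q.+2]; the exponent of [P] may be reduced because
    it only multiplies [s]. A cycle uses edges in both directions. *)
Lemma tanner_shift : exists2 s : 'I_q.+2, s != 0 & forall i j x y,
  (e (col j y) (row i x) = (y == x + a i * enum_val j * s)) *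
  (e (row i x) (col j y) = (y == x + a i * enum_val j * s)).
Proof.
have [s s0 sP] := circulant_perm_shift Pcirc; exists s => // i j x y.
rewrite /= array_code_entry sP -[s *+ _]mulr_natl natrM !natr_Zp.
by split.
Qed.

(** Starting at column 0 of block [j0], every further vertex is forced by the blocks visited, and
    the walk returns to its start when [s] times the given sum vanishes. Distinct blocks make the
    vertices distinct. *)
Lemma six_cycle (i0 i1 i2 : 'I_r) (j0 j1 j2 : 'I_#|~: D|) :
  uniq [:: i0; i1; i2] -> uniq [:: j0; j1; j2] ->
  a i0 * (enum_val j1 - enum_val j0) + a i1 * (enum_val j2 - enum_val j1)
    + a i2 * (enum_val j0 - enum_val j2) = 0 ->
  exists2 c, simple_cycle e c & size c = 6.
Proof.
move=> Ui Uj closed; have [s _ sP] := tanner_shift; move: (tanner _) sP => g sP.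
set A := a in closed sP. pose J (j : 'I_#|~: D|) : 'I_q.+2 := enum_val j.
(* Chosen so that row [w0] of block-row [i0] meets column 0 of block [j0]. *)
pose w0 : 'I_q.+2 := - (A i0 * J j0 * s).
pose c1 := w0 + A i0 * J j1 * s.
pose w1 := c1 - A i1 * J j1 * s.
pose c2 := w1 + A i1 * J j2 * s.
pose w2 := c2 - A i2 * J j2 * s.
exists [:: col j0 0; row i0 w0; col j1 c1; row i1 w1; col j2 c2; row i2 w2] => //.
split=> //; apply/andP; split.
  have end0 : 0 = w2 + A i2 * J j0 * s.
    rewrite -[LHS](mul0r s) -closed /w2 /c2 /w1 /c1 /w0 /J; ring.
  by rewrite /= !sP -!/(J _) -end0 /w2 /w1 /w0 addNr !subrK !eqxx.
move: Ui Uj; rewrite /= !inE !col_eq !row_eq !orbF !negb_or !andbT.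
by do !move=> /andP[] || case/andP=> ? ?; repeat case: eqP => //.
Qed.

(* The walk may visit a block-column twice (j0 = j2 or j1 = j3), but then in
   different columns of that block. *)
Lemma eight_cycle (i0 i1 : 'I_r) (j0 j1 j2 j3 : 'I_#|~: D|) :
  (forall x y : 'I_q.+2, x * y = 0 -> x = 0 \/ y = 0) -> a i0 != a i1 ->
  j0 != j1 -> j1 != j2 -> j2 != j3 -> j3 != j0 ->
  enum_val j0 + enum_val j2 = enum_val j1 + enum_val j3 :> 'I_q.+2 ->
  exists2 c, simple_cycle e c & size c = 8.
Proof.
move=> intg ai j01 j12 j23 j30 closed.
have [s s0 sP] := tanner_shift; move: (tanner _) sP => g sP.
set A := a in ai sP. pose J (j : 'I_#|~: D|) : 'I_q.+2 := enum_val j.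
have mul_neq0 x y : x != 0 -> y != 0 -> x * y != 0 :> 'I_q.+2.
  by move=> x0 y0; apply/eqP => /intg[]/eqP; apply/negP.
have J_neq j j' : j != j' -> J j - J j' != 0.
  by rewrite subr_eq0 (inj_eq enum_val_inj).
have Ad : A i1 - A i0 != 0 by rewrite subr_eq0 eq_sym.
have step j j' : j != j' -> s * ((A i1 - A i0) * (J j - J j')) != 0.
  by move=> /J_neq jj; rewrite !mul_neq0.
pose w0 : 'I_q.+2 := - (A i0 * J j0 * s).
pose c1 := w0 + A i0 * J j1 * s.
pose w1 := c1 - A i1 * J j1 * s.
pose c2 := w1 + A i1 * J j2 * s.
pose w2 := c2 - A i0 * J j2 * s.
pose c3 := w2 + A i0 * J j3 * s.
pose w3 := c3 - A i1 * J j3 * s.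
have end0 : 0 = w3 + A i1 * J j0 * s.
  rewrite /w3 /c3 /w2 /c2 /w1 /c1 /w0.
  have -> : J j0 = J j1 + J j3 - J j2 by rewrite -[RHS]/(_ - _) -closed addrK.
  by ring.
(* Each block-row is visited twice; the two rows differ by a product of nonzero factors, hence the
   need for integrality. *)
have w02 : w0 != w2.
  rewrite eq_sym -subr_eq0 (_ : _ - _ = s * ((A i1 - A i0) * (J j2 - J j1))).
    by rewrite step // eq_sym.
  by rewrite /w2 /c2 /w1 /c1 /w0; ring.
have w13 : w1 != w3.
  rewrite eq_sym -subr_eq0 (_ : _ - _ = s * ((A i1 - A i0) * (J j2 - J j3))).
    by rewrite step.
  by rewrite /w3 /c3 /w2 /c2; ring.
have c02 : (j0 == j2) && (0 == c2) = false.
  apply/negP => /andP[/eqP j02].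
  rewrite eq_sym (_ : c2 = s * ((A i1 - A i0) * (J j2 - J j1))).
    by apply/negP; rewrite step // eq_sym.
  by rewrite /c2 /w1 /c1 /w0 j02; ring.
have c13 : (j1 == j3) && (c1 == c3) = false.
  apply/negP => /andP[/eqP j13].
  rewrite eq_sym -subr_eq0 (_ : _ - _ = s * ((A i1 - A i0) * (J j2 - J j1))).
    by apply/negP; rewrite step // eq_sym.
  by rewrite /c3 /w2 /c2 /w1 j13; ring.
exists [:: col j0 0; row i0 w0; col j1 c1; row i1 w1;
           col j2 c2; row i0 w2; col j3 c3; row i1 w3] => //.
split=> //; apply/andP; split.
  by rewrite /= !sP -!/(J _) -end0 /w3 /w2 /w1 /w0 addNr !subrK !eqxx.
have i01 : i0 != i1 by apply: contraNneq ai => ->.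
rewrite /= !inE !col_eq !row_eq !orbF c02 c13 !eqxx !(negPf w02) !(negPf w13).
rewrite !(eq_sym i1) !(negPf i01) (negPf j01) (negPf j12) (negPf j23).
by rewrite (eq_sym j0) (negPf j30).
Qed.

End TannerCycles.

(** * Additive structure of the remaining block-columns *)

Lemma Zp_integral (q : nat) : prime q.+2 ->
  forall x y : 'I_q.+2, x * y = 0 -> x = 0 \/ y = 0.
Proof.
move=> qP x y /(congr1 val) /= /eqP xy0.
have : (q.+2 %| x * y)%N by [].
rewrite Euclid_dvdM // => /orP[] /eqP; rewrite modn_small // => z0; [left|right];
  exact: val_inj.
Qed.

Definition remaining (q : nat) (D : {set 'I_q}) (x : nat) : bool :=
  if insub x is Some i then i \in ~: D else false.

Lemma sum_remaining (q : nat) (D : {set 'I_q}) :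
  (\sum_(x < q) remaining D x)%N = #|~: D|.
Proof.
rewrite -sum1_card [RHS]big_mkcond; apply: eq_bigr => x _.
by rewrite /remaining valK; case: ifP.
Qed.

Lemma remainingP (q : nat) (D : {set 'I_q}) (x : nat) :
  remaining D x -> exists j : 'I_#|~: D|, x = enum_val j.
Proof.
rewrite /remaining; case: insubP => // i _ <- iD.
by exists (enum_rank_in iD i); rewrite enum_rankK_in.
Qed.

(** With labels b, b + d, b + 2d and block-columns in the order y, x, z, the closing sum of
    [six_cycle] is d (2 y - x - z). A nontrivial progression would thus give a 6-cycle, below the
    girth. *)
Lemma remaining_ap3_free (q r : nat) (P : 'M['F_2]_q.+2) (a : 'I_r -> 'I_q.+2)
    (D : {set 'I_q.+2}) :
  nontrivial_circulant_perm P -> (3 <= r)%N -> arithmetic_progression a ->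
  has_girth (tanner (delete_block_cols D (array_pcm P a))) 8 ->
  ap3_free q.+2 (remaining D).
Proof.
move=> Pc r3 [b [d [_ aE]]] [_ girth] x y z _ _ _.
move=> /remainingP[jx ->] /remainingP[jy ->] /remainingP[jz ->] xyz.
have [-> //|xz] := eqVneq jx jz.
have xy : jx != jy.
  apply: contra xz => /eqP xy; move: xyz.
  by rewrite -xy -addnn => /addnI/val_inj/enum_val_inj ->.
have yz : jy != jz.
  apply: contra xz => /eqP yz; move: xyz.
  by rewrite yz -addnn => /addIn/val_inj/enum_val_inj ->.
pose i0 := Ordinal (leq_trans (isT : 0 < 3)%N r3).
pose i1 := Ordinal (leq_trans (isT : 1 < 3)%N r3).
pose i2 := Ordinal r3.
have aZ i : a i = b%:~R + d%:~R * (i : nat)%:R :> 'I_q.+2.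
  rewrite -[LHS]natr_Zp pmulrn aE intrD; congr (_ + _).
  by rewrite -[d *+ _]mulr_natr intrM natz -pmulrn.
have xyz' : enum_val jx + enum_val jz = 2%:R * enum_val jy :> 'I_q.+2.
  rewrite -[enum_val jx]natr_Zp -[enum_val jz]natr_Zp -[enum_val jy]natr_Zp.
  by rewrite -natrM -natrD xyz mul2n.
have Uj : uniq [:: jy; jx; jz] by rewrite /= !inE negb_or [jy == jx]eq_sym xy yz xz.
have [|c cP c6] := @six_cycle _ _ P a D Pc i0 i1 i2 jy jx jz isT Uj.
  rewrite !aZ /=.
  transitivity (d%:~R * (2%:R * enum_val jy - (enum_val jx + enum_val jz)) : 'I_q.+2).
    by ring.
  by rewrite xyz' subrr mulr0.
by have := girth c cP; rewrite c6.
Qed.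

(** Differences of distinct block-columns are pairwise distinct and lie among the [q.+1] nonzero
    residues. *)
Lemma remaining_card_le (q r : nat) (P : 'M['F_2]_q.+2) (a : 'I_r -> 'I_q.+2)
    (D : {set 'I_q.+2}) :
  prime q.+2 -> nontrivial_circulant_perm P -> (2 <= r)%N -> injective a ->
  has_girth (tanner (delete_block_cols D (array_pcm P a))) 10 ->
  (#|~: D| * #|~: D| <= #|~: D| + q.+1)%N.
Proof.
move=> qP Pc r2 a_inj [_ girth]; set n := #|~: D|.
pose i0 := Ordinal (leq_trans (isT : 0 < 2)%N r2).
pose i1 := Ordinal r2.
have a01 : a i0 != a i1 by rewrite (inj_eq a_inj).
pose V (j : 'I_n) : 'I_q.+2 := enum_val j.
pose diff (p : 'I_n * 'I_n) := V p.1 - V p.2.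
pose offdiag := [set p : 'I_n * 'I_n | p.1 != p.2].
have diff_inj : {in offdiag &, injective diff}.
  move=> [x y] [z w]; rewrite !inE /= => xy zw dE.
  have sumE : V x + V w = V y + V z.
    by rewrite -[V x](subrK (V y)) [V x - V y]dE /diff /=; ring.
  (* If y = w or x = z, cancellation identifies the two pairs. Otherwise consecutive entries of x,
     y, w, z differ, which is all that [eight_cycle] asks; x = w or y = z may occur. *)
  have [yw|yw] := eqVneq y w.
    by move: sumE; rewrite yw addrC => /addrI/enum_val_inj ->.
  have [xz|xz] := eqVneq x z.
    by move: sumE; rewrite xz addrC => /addIr/enum_val_inj ->.
  rewrite eq_sym in zw; rewrite eq_sym in xz.
  have [c cP c8] := eight_cycle (P := P) Pc (Zp_integral qP) a01 xy yw zw xz sumE.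
  by have := girth c cP; rewrite c8.
have diag : #|~: offdiag| = n.
  rewrite -[RHS]card_ord -(card_imset _ (f := fun x : 'I_n => (x, x))); last first.
    by move=> x y [].
  apply: eq_card => -[x y]; rewrite !inE /= negbK.
  apply/eqP/imsetP => [->|[z _ [-> ->]] //].
  by exists y.
have : (#|offdiag| <= q.+1)%N.
  rewrite -(card_in_imset diff_inj).
  apply: (@leq_trans #|[set~ (0 : 'I_q.+2)]|); last by rewrite cardsC1 card_ord.
  apply: subset_leq_card; apply/subsetP => _ /imsetP[[x y] + ->].
  by rewrite !inE subr_eq0 /= (inj_eq enum_val_inj).
have := cardsC offdiag; rewrite diag card_prod card_ord; lia.
Qed.

Theorem theorem5 (R : realType) :
  (exists2 c0 : R, 0 < c0 &
     forall (q r : nat) (P : 'M['F_2]_q) (a : 'I_r -> 'I_q) (D : {set 'I_q}),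
       prime q -> odd q -> nontrivial_circulant_perm P ->
       (3 <= r <= q)%N -> injective a -> arithmetic_progression a ->
       has_girth (tanner (delete_block_cols D (array_pcm P a))) 8 ->
       #|~: D|%:R <= c0 * q%:R / ln (ln q%:R)) /\
  (forall (q r : nat) (P : 'M['F_2]_q) (a : 'I_r -> 'I_q) (D : {set 'I_q}),
     prime q -> odd q -> nontrivial_circulant_perm P ->
     (2 <= r <= q)%N -> injective a ->
     has_girth (tanner (delete_block_cols D (array_pcm P a))) 10 ->
     #|~: D|%:R <= Num.sqrt (q%:R - 3 / 4) + 1 / 2 :> R).
Proof.
split.
  exists 54; first by [].
  move=> [|[|q]] r P a D // _ _ Pc /andP[r3 rq] _ aAP girth.
  rewrite -sum_remaining ap3_free_le ?(leq_trans r3 rq) //.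
  exact: remaining_ap3_free girth.
move=> [|[|q]] r P a D // qP _ Pc /andP[r2 _] a_inj girth.
have := remaining_card_le qP Pc r2 a_inj girth.
move: #|~: D| => n; rewrite -(ler_nat R) natrM natrD => nq.
(* Completing the square: n^2 <= n + q - 1 amounts to (n - 1/2)^2 <= q - 3/4 for the modulus q, and
   the root of a square is an absolute value. *)
rewrite -lerBlDr; apply: le_trans (ler_norm _) _.
rewrite -sqrtr_sqr ler_wsqrtr // -[q.+2%:R]natr1; nra.
Qed.
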